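(* Let $A\in\mathbf{C}^{n\times n}$. If the nonlinear matrix equation $X+A^{*}\overline{X}^{-1}A=I_{n}$ has a positive definite solution, then $\rho\left(A\overline{A}\right)\leq\frac{1}{4}$, $\left\Vert A\right\Vert<1$, and, for each choice of sign, $$\rho\left(\left(A\pm\overline{A}^{*}\right)\left(\overline{A\pm\overline{A}^{*}}\right)\right)\leq 1,$$ which can be equivalently rewritten as $\mathrm{co}\rho\left(A\pm\overline{A}^{*}\right)\leq 1$.
   Context: Notation: $\overline{M}$, $M^{*}$ denote the entrywise conjugate and the conjugate transpose of a complex matrix $M$; $\rho(M)$ is the spectral radius and $\Vert M\Vert$ the $2$-norm (spectral norm). Two matrices $M,B\in\mathbf{C}^{n\times n}$ are con-similar if there is a nonsingular $S\in\mathbf{C}^{n\times n}$ with $S^{-1}B\overline{S}=M$. Let $J_k(\lambda)$ denote the $k\times k$ Jordan block with diagonal entries $\lambda$. Every $M\in\mathbf{C}^{n\times n}$ is con-similar to a direct sum of blocks (its canonical form) each of which is either $J_k(\lambda)$ with $\lambda\ge 0$, or $\begin{bmatrix}0&I_k\\ J_k(\lambda)&0\end{bmatrix}$ with $\lambda<0$ or $\mathrm{Im}(\lambda)\neq 0$. The con-spectrum $\mathrm{co}\lambda(M)$ is the set of numbers $\lambda$ appearing in the $J_k(\lambda)$ in the blocks of this canonical form, and the con-spectral-radius is $\mathrm{co}\rho(M)=\max\{|\lambda|:\lambda\in\mathrm{co}\lambda(M)\}$. *)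

(* Defs.v *)
From HB Require Import structures.
From mathcomp Require Import all_boot all_order all_algebra.
From mathcomp Require Import complex.
From mathcomp Require Import boolp classical_sets reals.

Set Implicit Arguments.
Unset Strict Implicit.
Unset Printing Implicit Defensive.

Import Order.TTheory GRing.Theory Num.Theory Num.Def.

Local Open Scope classical_set_scope.
Local Open Scope ring_scope.
Local Open Scope complex_scope.
Local Open Scope sesquilinear_scope.

(* [M ^conj] is the entrywise conjugate; the library's [M ^t*] is the conjugate *)
(* transpose.  [sup] is the supremum in [R], with [sup set0 = 0].               *)
Notation "M ^conj" := (map_mx conjC M) (at level 30) : ring_scope.

Definition cabs (R : realType) (z : R[i]) : R := complex.Re `|z|.

Definition spectral_radius (R : realType) (n : nat) (M : 'M[R[i]]_n) : R :=
  sup [set cabs a | a in [set a | eigenvalue M a]].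

Definition vnorm2 (R : realType) (n : nat) (v : 'cV[R[i]]_n) : R :=
  Num.sqrt (\sum_(i < n) cabs (v i 0) ^+ 2).

Definition mxnorm2 (R : realType) (m n : nat) (M : 'M[R[i]]_(m, n)) : R :=
  sup [set vnorm2 (M *m v) | v in [set v : 'cV[R[i]]_n | vnorm2 v <= 1]].

Definition posdefmx (R : realType) (n : nat) (X : 'M[R[i]]_n) : Prop :=
  X \is hermsymmx /\
  forall v : 'cV[R[i]]_n, v != 0 -> 0 < (v ^t* *m X *m v) 0 0.

Definition consimilar (R : realType) (n : nat) (M B : 'M[R[i]]_n) : Prop :=
  exists2 S : 'M[R[i]]_n, S \in unitmx & invmx S *m B *m (S ^conj) = M.

Definition jordan_block (R : realType) (k : nat) (l : R[i]) : 'M[R[i]]_k :=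
  \matrix_(i < k, j < k) (l *+ (i == j) + (i.+1 == j :> nat)%:R).

Inductive conblock (R : realType) : Type :=
| ConJordan of nat & R[i]
| ConPair of nat & R[i].

Definition conblock_val (R : realType) (b : conblock R) : R[i] :=
  match b with ConJordan _ l => l | ConPair _ l => l end.

(* Empty blocks are excluded, as they would put arbitrary values in the         *)
(* con-spectrum.  In [R[i]], [0 <= l] and [l < 0] imply that [l] is real.       *)
Definition conblock_valid (R : realType) (b : conblock R) : Prop :=
  match b with
  | ConJordan k l => (0 < k)%N /\ 0 <= l
  | ConPair k l => (0 < k)%N /\ (l < 0 \/ complex.Im l != 0)
  end.

Definition conblock_dim (R : realType) (b : conblock R) : nat :=
  match b with ConJordan k _ => k | ConPair k _ => (k + k)%N end.

Definition conblock_mx (R : realType) (b : conblock R) :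
    'M[R[i]]_(conblock_dim b) :=
  match b with
  | ConJordan k l => jordan_block k l
  | ConPair k l => block_mx 0 1%:M (jordan_block k l) 0
  end.

Definition con_canonical_form (R : realType) (n : nat) (M : 'M[R[i]]_n)
    (r : nat) (b : 'I_r -> conblock R) : Prop :=
  (forall i, conblock_valid (b i)) /\
  exists e : (\sum_(i < r) conblock_dim (b i))%N = n,
    consimilar M (castmx (e, e) (\mxdiag_(i < r) conblock_mx (b i))).

(* The canonical form is unique up to the order of the blocks and the           *)
(* replacement of [l] by its conjugate in a [ConPair] block.  All canonical     *)
(* forms are considered here, so such an [l] comes with its conjugate; this     *)
(* does not affect the moduli.                                                  *)
Definition con_spectrum (R : realType) (n : nat) (M : 'M[R[i]]_n) : set R[i] :=
  [set l | exists (r : nat) (b : 'I_r -> conblock R) (i : 'I_r),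
     con_canonical_form M b /\ conblock_val (b i) = l].

Definition con_spectral_radius (R : realType) (n : nat) (M : 'M[R[i]]_n) : R :=
  sup [set cabs l | l in con_spectrum M].

(* Main.v *)
Require Import Defs.
From HB Require Import structures.
From mathcomp Require Import all_boot all_order all_algebra.
From mathcomp Require Import complex ring lra.
From mathcomp Require Import boolp classical_sets reals.

Set Implicit Arguments.
Unset Strict Implicit.
Unset Printing Implicit Defensive.

Import Order.TTheory GRing.Theory Num.Theory Num.Def.

Local Open Scope classical_set_scope.
Local Open Scope ring_scope.
Local Open Scope complex_scope.
Local Open Scope sesquilinear_scope.

(** A positive definite solution makes the bilinear form of [A] small.  Writing
[q w] for [w *m X ^conj *m w ^t*], completing the square in [q] and replacing
[A ^t* *m invmx (X ^conj) *m A] by [1 - X] gives, for all rows [w] and [v],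
[2 * |w *m A *m v^T| <= q w + (|v|^2 - q v)] ([norm_form_le]), and each bound
is read off from it.

If [x] is a row eigenvector of [M *m M ^conj] for [a] and [y] is the conjugate
of [x *m M], then [x *m M] is the conjugate of [y] and [y *m M] is [a^*] times
the conjugate of [x].  Using the inequality at [(r x, y)] and at [(y, r x)],
with [r^2 = |a|], and adding, the terms in [q] cancel and [2 r <= 1] is left
([eigenvalue_coneigen_bound]).  For [A + s *: A^T] with [|s| = 1], the sum of
the inequalities at [(w, v)] and at [(v, w)] is an inequality of the same shape
in which [q] is [|.|^2] and the constant is 2; it yields [r <= 1].  At
[w = (A v)^*] the inequality says [|A v|^2 <= |v|^2 - q v], and since [q] is
bounded below by a positive multiple of [|.|^2] the norm of [A] is less than 1.

For the con-spectral radius, [A + A^T] is symmetric and [A - A^T] is skew, so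
only these two kinds of [B] matter.  A block with parameter [l] in a canonical
form of [B] gives the eigenvalue [|l|^2] or [l] of [B *m B ^conj], according to
the kind of block; both have modulus at most 1 exactly when [l] does.
Conversely every eigenvalue of [B *m B ^conj] comes from a block of some
canonical form: the conjugate-linear map that sends [x] to the conjugate of
[x *m B] preserves orthogonal complements of its invariant subspaces, so a
canonical form whose blocks have [k = 1] is built greedily, one orthogonal
block at a time, starting from any eigenvector ([eigenvalue_canonical]). *)

(** * Hermitian forms and the spectrum of [M *m M ^conj] *)

Local Notation "''[' u ]" := (dotmx u u) : ring_scope.

Definition hermform (C : numClosedFieldType) n (Y : 'M[C]_n)
    (w : 'rV[C]_n) : C :=
  (w *m Y *m w ^t*) 0 0.

Section Forms.
Variables (C : numClosedFieldType).
Implicit Types (n : nat).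

Lemma trmxC_mul m n p (M : 'M[C]_(m, n)) (N : 'M[C]_(n, p)) :
  (M *m N) ^t* = N ^t* *m M ^t*.
Proof. by rewrite trmx_mul map_mxM. Qed.

Lemma trmxC_conj m n (M : 'M[C]_(m, n)) : (M ^conj) ^t* = M^T.
Proof. by apply/matrixP => i j; rewrite !mxE; exact: conjCK. Qed.

Lemma conjmxK m n (M : 'M[C]_(m, n)) : (M ^conj) ^conj = M.
Proof. by apply/matrixP => i j; rewrite !mxE; exact: conjCK. Qed.

Lemma mx11Z (a : C) (M : 'M[C]_1) : (a *: M) 0 0 = a * M 0 0.
Proof. by rewrite mxE. Qed.

Lemma mx11D (M N : 'M[C]_1) : (M + N) 0 0 = M 0 0 + N 0 0.
Proof. by rewrite mxE. Qed.

Lemma mx11N (M : 'M[C]_1) : (- M) 0 0 = - M 0 0.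
Proof. by rewrite mxE. Qed.

Lemma trmxZ m n (a : C) (M : 'M[C]_(m, n)) : (a *: M)^T = a *: M^T.
Proof. exact: linearZ. Qed.

Lemma mx11_tr (M : 'M[C]_1) : M^T 0 0 = M 0 0.
Proof. by rewrite mxE. Qed.

Lemma dotmx_conj n (v : 'rV[C]_n) : (v ^conj *m v^T) 0 0 = '[v].
Proof. by rewrite dotmxE -mx11_tr trmx_mul trmxK -map_trmx. Qed.

Lemma hermformZ n (Y : 'M[C]_n) (a : C) (w : 'rV[C]_n) :
  hermform Y (a *: w) = `|a| ^+ 2 * hermform Y w.
Proof.
rewrite /hermform -scalemxAl linearZ /= map_mxZ -scalemxAr -scalemxAl scalerA.
by rewrite mxE normCK; congr (_ * _); exact: mulrC.
Qed.

(** The function [q] is arbitrary because it cancels between the two uses of the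
inequality; this lets one statement serve both for [A], with the form of the
solution and [c = 1], and for [A + s *: A^T], with the norm and [c = 2]. *)
Lemma eigenvalue_coneigen_bound n (M : 'M[C]_n) (q : 'rV[C]_n -> C) (c : C) :
  0 <= c ->
  (forall a w, q (a *: w) = `|a| ^+ 2 * q w) ->
  (forall w v, `|(w *m M *m v^T) 0 0| *+ 2 <= q w + (c * '[v] - q v)) ->
  forall a, eigenvalue (M *m M ^conj) a -> `|a| <= (c / 2) ^+ 2.
Proof.
move=> c_ge0 qZ Hq a /eigenvalueP [x xMM x_neq0].
have [->|a_neq0] := eqVneq a 0; first by rewrite normr0 exprn_ge0 ?divr_ge0.
set r := sqrtC `|a|.
have r_gt0 : 0 < r by rewrite sqrtC_gt0 normr_gt0.
have r2 : r ^+ 2 = `|a| by rewrite sqrtCK.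
set y := (x *m M) ^conj.
have xM : x *m M = y ^conj by rewrite conjmxK.
have yM : y *m M = conjC a *: x ^conj.
  by rewrite -map_mxZ -xMM mulmxA xM map_mxM /= !conjmxK.
(* The factor [r] balances the two left-hand sides: [r |y|^2] and [r^3 |x|^2]. *)
have := lerD (Hq (r *: x) y) (Hq y (r *: x)).
rewrite yM -!scalemxAl xM qZ trmxZ -scalemxAr !mx11Z !dotmx_conj.
rewrite !normrM norm_conjC dnormZ (ger0_norm (ltW r_gt0)) -r2.
rewrite !(ger0_norm (dnorm_ge0 _ _)) => H.
have {}H : r * ('[y] + r ^+ 2 * '[x]) *+ 2 <= c * ('[y] + r ^+ 2 * '[x]).
  rewrite -subr_ge0; rewrite -subr_ge0 in H.
  by apply: (eq_ind _ (fun z => 0 <= z) H); ring.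
have N_gt0 : 0 < '[y] + r ^+ 2 * '[x].
  by rewrite ltr_wpDl ?dnorm_ge0 // mulr_gt0 ?exprn_gt0 // dnorm_gt0.
rewrite lerXn2r ?nnegrE ?divr_ge0 ?(ltW r_gt0) //.
by rewrite ler_pdivlMr // -(ler_pM2r N_gt0) mulrAC mulr_natr.
Qed.

(** * The fundamental inequality of a positive definite solution *)

Section SolutionInequality.
Variables (n : nat) (A X : 'M[C]_n).
Hypothesis (Xherm : X ^t* = X).
Hypothesis (Xpos : forall v : 'cV[C]_n, v != 0 -> 0 < (v ^t* *m X *m v) 0 0).
Hypothesis (Xeq : X + A ^t* *m invmx (X ^conj) *m A = 1%:M).

Let Y := X ^conj.
Lemma hermform_conj (w : 'rV[C]_n) : (w ^conj *m X *m w^T) 0 0 = hermform Y w.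
Proof.
rewrite /hermform -mx11_tr !trmx_mul trmxK mulmxA -map_trmx.
by rewrite -[X in LHS]Xherm /Y -map_trmx trmxK.
Qed.

Lemma hermform_gt0 w : w != 0 -> 0 < hermform Y w.
Proof.
move=> w0; rewrite -hermform_conj.
have := @Xpos w^T; rewrite trmxK trmx_eq0; exact.
Qed.

Lemma hermform_ge0 w : 0 <= hermform Y w.
Proof.
have [->|/hermform_gt0/ltW//] := eqVneq w 0.
by rewrite /hermform !mul0mx mxE.
Qed.

Lemma conj_unitmx : Y \in unitmx.
Proof.
rewrite -row_free_unit -kermx_eq0; apply/eqP/row_matrixP => i; rewrite row0.
apply/eqP/negPn/negP => /hermform_gt0.
by rewrite /hermform -row_mul mulmx_ker row0 mul0mx mxE ltxx.
Qed.

(** Completing the square: as a function of [w], the difference of the two sides is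
least at [w0 = v ^conj *m A ^t* *m invmx Y], and by the equation for [X] it is
[hermform Y (w - w0)]. *)
Lemma Re_form_le w v :
  (w *m A *m v^T) 0 0 + conjC ((w *m A *m v^T) 0 0) <=
  hermform Y w + ('[v] - hermform Y v).
Proof.
set Z := invmx Y.
have Yh : Y ^t* = Y by rewrite trmxC_conj /Y -[in RHS]Xherm conjmxK.
have Zh : Z ^t* = Z by rewrite /Z trmx_inv map_invmx Yh.
have YZ : Y *m Z = 1%:M by rewrite mulmxV ?conj_unitmx.
have ZY : Z *m Y = 1%:M by rewrite mulVmx ?conj_unitmx.
pose p := w - v ^conj *m A ^t* *m Z.
have pY : p *m Y = w *m Y - v ^conj *m A ^t*.
  by rewrite mulmxBl -[_ *m Z *m Y]mulmxA ZY mulmx1.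
have ps : p ^t* = w^t* - Z *m A *m v^T.
  by rewrite linearB /= map_mxB !trmxC_mul Zh trmxCK trmxC_conj mulmxA.
have zC : conjC ((w *m A *m v^T) 0 0) = (v ^conj *m A ^t* *m w ^t*) 0 0.
  by rewrite -mx11_tr !trmx_mul trmxK mulmxA -!map_mxM [RHS]mxE.
have vE : '[v] - hermform Y v = (v ^conj *m A ^t* *m Z *m A *m v^T) 0 0.
  rewrite -dotmx_conj -hermform_conj -[v ^conj in X in X - _]mulmx1 -Xeq.
  by rewrite mulmxDr mulmxDl mx11D addrAC subrr add0r !mulmxA.
suff -> : hermform Y w + ('[v] - hermform Y v) = hermform Y p +
   ((w *m A *m v^T) 0 0 + conjC ((w *m A *m v^T) 0 0)).
  by rewrite lerDr hermform_ge0.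
rewrite vE zC {2}/hermform pY ps mulmxBl !mulmxBr.
rewrite !(mx11D, mx11N) !mulmxA -[w *m Y *m Z]mulmxA YZ mulmx1 /hermform.
ring.
Qed.

(** The right-hand side does not change when [w] is multiplied by a number of
modulus 1, so the phase of the form can be rotated away. *)
Lemma norm_form_le w v :
  `|(w *m A *m v^T) 0 0| *+ 2 <= hermform Y w + ('[v] - hermform Y v).
Proof.
set z := (w *m A *m v^T) 0 0.
have [z0|z_neq0] := eqVneq z 0.
  rewrite z0; have := Re_form_le w v; rewrite -/z z0 conjC0 addr0.
  by rewrite normr0 mul0rn.
have := Re_form_le ((conjC z / `|z|) *: w) v.
rewrite -!scalemxAl mxE -/z hermformZ normf_div norm_conjC normr_id.
rewrite divff ?normr_eq0 // expr1n mul1r.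
have -> : conjC z / `|z| * z = `|z|.
  by rewrite mulrAC [conjC z * z]mulrC -normCK expr2 mulfK ?normr_eq0.
by rewrite (CrealP (normr_real z)) mulr2n.
Qed.

Lemma hermform_le w : hermform Y w <= '[w].
Proof.
have := norm_form_le 0 w.
rewrite !mul0mx mxE normr0 mul0rn /hermform !mul0mx mxE add0r.
by rewrite subr_ge0.
Qed.

Lemma dotmx_mul_le (v : 'cV[C]_n) :
  '[(A *m v)^T] <= '[v^T] - hermform Y v^T.
Proof.
have E : ((A *m v) ^t* *m A *m v) 0 0 = '[(A *m v)^T].
  by rewrite -mulmxA -dotmx_conj trmxK.
have := norm_form_le ((A *m v) ^t*) v^T.
rewrite trmxK E ger0_norm ?dnorm_ge0 // => H.
have := le_trans H (lerD (hermform_le _) (lexx _)).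
have -> : '[(A *m v) ^t*] = '[(A *m v)^T].
  by rewrite [LHS]dotmxE trmxCK -[RHS]dotmx_conj trmxK.
by rewrite mulr2n lerD2l.
Qed.

End SolutionInequality.

(** In an orthonormal basis of eigenvectors the form is a sum of squares with
positive weights [d 0 i]; the constant [1 + \sum_i (d 0 i)^-1] exceeds every
[(d 0 i)^-1] and stays positive in dimension 0. *)
Lemma hermform_coercive n (Y : 'M[C]_n) : Y \is hermsymmx ->
  (forall w : 'rV_n, w != 0 -> 0 < hermform Y w) ->
  exists2 K : C, 0 < K & forall w, '[w] <= K * hermform Y w.
Proof.
move=> /hermitian_normalmx /orthomx_spectralP; set P := spectralmx Y.
set d := spectral_diag Y => YE Ypos.
have Pu : P \is unitarymx by apply: spectral_unitarymx.
rewrite (invmx_unitary Pu) in YE.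
have PP : P *m P ^t* = 1%:M by apply/unitarymxP.
have PP' : P ^t* *m P = 1%:M.
  by rewrite -(invmx_unitary Pu) mulVmx ?unitarymx_unit.
have Yd (u : 'rV_n) : hermform Y (u *m P) = \sum_i d 0 i * `|u 0 i| ^+ 2.
  rewrite /hermform {1}YE trmxC_mul !mulmxA -(mulmxA u) PP mulmx1.
  rewrite -(mulmxA _ P (P ^t*)) PP mulmx1 mxE; apply: eq_bigr => i _.
  by rewrite mul_mx_diag !mxE normCK mulrAC mulrC; congr (_ * _); exact: mulrC.
have uE (u : 'rV_n) : '[u *m P] = \sum_i `|u 0 i| ^+ 2.
  rewrite dotmxE trmxC_mul mulmxA -(mulmxA u) PP mulmx1 mxE.
  by apply: eq_bigr => i _; rewrite !mxE normCK.
have d_gt0 i : 0 < d 0 i.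
  have := Ypos (delta_mx 0 i *m P).
  rewrite Yd (bigD1 i) //= big1 => [|j /negPf ji]; last first.
    by rewrite !mxE ji /= normr0 expr0n mulr0.
  rewrite addr0 mxE !eqxx normr1 expr1n mulr1; apply.
  suff : '[delta_mx 0 i *m P] != 0 by rewrite dnorm_eq0.
  rewrite uE (bigD1 i) //= !mxE !eqxx normr1 expr1n.
  by rewrite gt_eqF // ltr_wpDr ?ltr01 // sumr_ge0 // => j _; rewrite exprn_ge0.
have dV_ge0 i : 0 <= (d 0 i)^-1 by rewrite invr_ge0 ltW.
exists (1 + \sum_i (d 0 i)^-1) => [|w].
  by rewrite ltr_wpDr ?ltr01 ?sumr_ge0.
rewrite -[w]mulmx1 -PP' mulmxA uE Yd mulr_sumr; apply: ler_sum => i _.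
rewrite mulrA ler_peMl ?exprn_ge0 // -[leLHS](mulVf (lt0r_neq0 (d_gt0 i))).
by rewrite ler_pM2r // (bigD1 i) //= addrCA lerDl addr_ge0 ?ler01 ?sumr_ge0.
Qed.

End Forms.

(** * Spectral radius and spectral norm *)

Section Radius.
Variable R : realType.
Implicit Types (n : nat).

Lemma normcE (z : R[i]) : `|z| = (cabs z)%:C.
Proof. by rewrite /cabs normc_def. Qed.

Lemma cabs_le (z : R[i]) (c : R) : (cabs z <= c) = (`|z| <= c%:C).
Proof. by rewrite normcE lecR. Qed.

Lemma spectral_radius_le n (M : 'M[R[i]]_n) (c : R) : 0 <= c ->
  (forall a, eigenvalue M a -> `|a| <= c%:C) -> spectral_radius M <= c.
Proof.
move=> c_ge0 Mc; rewrite /spectral_radius.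
have [[x Ex]|E0] :=
  pselect ([set cabs a | a in [set a | eigenvalue M a]] !=set0)%classic.
  apply: sup_le_ub; first by exists x.
  by move=> _ [a /Mc ac <-]; rewrite cabs_le.
suff -> : [set cabs a | a in [set a | eigenvalue M a]] = set0 by rewrite sup0.
by apply/eqP/negPn/negP => /set0P.
Qed.

(** There are finitely many eigenvalues, so their moduli are bounded and [sup] is
an upper bound. *)
Lemma eigenvalue_le_spectral_radius n (M : 'M[R[i]]_n) a :
  eigenvalue M a -> cabs a <= spectral_radius M.
Proof.
move=> Ma; apply: ub_le_sup; last by exists a.
have [s Ms] := closed_field_poly_normal (char_poly M).
exists (\sum_(z <- s) cabs z) => _ [b Mb <-].
have b_s : b \in s.
  move: Mb; rewrite /= eigenvalue_root_char Ms (monicP (char_poly_monic M)).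
  by rewrite scale1r root_prod_XsubC.
rewrite (big_rem b) //= lerDl sumr_ge0 // => z _.
by rewrite -lecR -normcE normr_ge0.
Qed.

(** The hypothesis is [|M v|^2 <= (1 - K^-1) * |v|^2] without the inverse.  A gap
uniform in [v] is needed because the norm is a supremum. *)
Lemma mxnorm2_lt1 m n (M : 'M[R[i]]_(m, n)) (K : R[i]) : 0 < K ->
  (forall v : 'cV_n, '[v^T] <= K * ('[v^T] - '[(M *m v)^T])) -> mxnorm2 M < 1.
Proof.
have vE p (v : 'cV[R[i]]_p) : (vnorm2 v ^+ 2)%:C = '[v^T].
  rewrite sqr_sqrtr; last by rewrite sumr_ge0 // => i _; rewrite exprn_even_ge0.
  rewrite dotmxE mxE rmorph_sum; apply: eq_bigr => i _.
  by rewrite rmorphXn /= -normcE normCK !mxE.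
move=> K_gt0 HM.
have [k Kk] : exists k : R, K = k%:C.
  by exists (cabs K); rewrite -normcE gtr0_norm.
rewrite {}Kk (ltcR 0) in K_gt0 HM.
have k1_gt0 : 0 < k + 1 by rewrite addr_gt0.
(* The sharp ratio [(k - 1) / k] may be negative; [k / (k + 1)] is larger and
   nonnegative, so it has a square root. *)
pose c := k / (k + 1).
have c_ge0 : 0 <= c by rewrite divr_ge0 // ltW.
have c_lt1 : c < 1 by rewrite ltr_pdivrMr // mul1r ltrDl.
have Mc (v : 'cV[R[i]]_n) : vnorm2 (M *m v) ^+ 2 <= c * vnorm2 v ^+ 2.
  have := HM v; rewrite -!vE -rmorphB -rmorphM lecR => H.
  rewrite /c mulrAC ler_pdivlMr //.
  have : 0 <= vnorm2 v ^+ 2 - vnorm2 (M *m v) ^+ 2.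
    by rewrite -(pmulr_rge0 _ K_gt0) (le_trans _ H) ?sqr_ge0.
  by lra.
apply: (@le_lt_trans _ _ (Num.sqrt c)); last first.
  by rewrite -sqrtr1 ltr_sqrt.
apply: sup_le_ub.
  exists (vnorm2 (M *m 0)), 0 => //=.
  rewrite /vnorm2 big1 ?sqrtr0 // => i _.
  by rewrite mxE /cabs normr0 expr0n.
move=> _ [v /= v1 <-]; rewrite -[leLHS]ger0_norm ?sqrtr_ge0 // -sqrtr_sqr.
rewrite ler_wsqrtr // (le_trans (Mc v)) // ler_piMr //.
by rewrite exprn_ile1 // sqrtr_ge0.
Qed.
End Radius.

(** * Necessary conditions for a positive definite solution *)

Section NecessaryConditions.
Variables (R : realType) (n : nat) (A X : 'M[R[i]]_n).
Hypothesis (Xpos : posdefmx X).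
Hypothesis (Xeq : X + A ^t* *m invmx (X ^conj) *m A = 1%:M).

Let Xherm : X ^t* = X.
Proof. by case: Xpos => /is_hermitianmxP; rewrite expr0 scale1r => /esym. Qed.

Let Xgt0 : forall v : 'cV_n, v != 0 -> 0 < (v ^t* *m X *m v) 0 0.
Proof. by case: Xpos. Qed.

Lemma spectral_radius_mul_conj_le : spectral_radius (A *m A ^conj) <= 4^-1.
Proof.
apply: spectral_radius_le => [|a Aa]; first by rewrite invr_ge0.
have H : forall w v : 'rV_n, `|(w *m A *m v^T) 0 0| *+ 2 <=
    hermform (X ^conj) w + (1 * '[v] - hermform (X ^conj) v).
  by move=> w v; rewrite mul1r norm_form_le.
have := eigenvalue_coneigen_bound ler01 (hermformZ _) H Aa.
suff -> : (1 / 2) ^+ 2 = (4^-1)%:C :> R[i] by [].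
by rewrite fmorphV /= rmorph_nat; field.
Qed.

Lemma mxnorm2_solvable_lt1 : mxnorm2 A < 1.
Proof.
have Yherm : X ^conj \is hermsymmx.
  apply/is_hermitianmxP.
  by rewrite expr0 scale1r -[in LHS]Xherm conjmxK /= trmxC_conj.
have [K K_gt0 HK] := hermform_coercive Yherm (hermform_gt0 Xherm Xgt0).
apply: (mxnorm2_lt1 K_gt0) => v; apply: le_trans (HK _) _.
rewrite ler_pM2l // lerBrDr -lerBrDl; exact: dotmx_mul_le.
Qed.

(** Since [w *m A^T *m v^T] is [v *m A *m w^T], the inequality for [A] at [(v, w)]
bounds it, and the forms of [X] cancel in the sum with the one at [(w, v)].  The
cases [s = 1] and [s = -1] are the two signs. *)
Lemma spectral_radius_symmetrized_le (s : R[i]) : `|s| = 1 ->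
  spectral_radius ((A + s *: A^T) *m (A + s *: A^T) ^conj) <= 1.
Proof.
set B := A + s *: A^T => s1; apply: spectral_radius_le => // a Ba.
have H : forall w v : 'rV_n, `|(w *m B *m v^T) 0 0| *+ 2 <=
    '[w] + (2 * '[v] - '[v]).
  move=> w v; rewrite /B mulmxDr mulmxDl mx11D -scalemxAr -scalemxAl mx11Z.
  rewrite -[(w *m A^T *m _) 0 0]mx11_tr !trmx_mul !trmxK mulmxA.
  have := lerD (norm_form_le Xherm Xgt0 Xeq w v)
    (norm_form_le Xherm Xgt0 Xeq v w).
  rewrite -mulrnDl => H.
  apply: le_trans (le_trans H _); last first.
    by rewrite le_eqVlt; apply/orP; left; apply/eqP; ring.
  by rewrite ler_pMn2r // (le_trans (ler_normD _ _)) // normrM s1 mul1r.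
have := eigenvalue_coneigen_bound (ler0n _ 2) (@dnormZ _ _ (@dotmx _ n)) H Ba.
by rewrite divff ?pnatr_eq0 // expr1n.
Qed.

End NecessaryConditions.

(** * Eigenvalues carried by a con-canonical form *)

Section CanonicalForm.
Variable R : realType.
Implicit Types (n : nat).

(** The row blocks [T i] of the con-similarity matrix satisfy independent
equations; this form has no casts and can be built one block at a time. *)
Lemma con_canonical_formP n (M : 'M[R[i]]_n) r (b : 'I_r -> conblock R) :
  con_canonical_form M b <->
  [/\ forall i, conblock_valid (b i),
      (\sum_(i < r) conblock_dim (b i))%N = n &
      exists2 T : forall i, 'M[R[i]]_(conblock_dim (b i), n),
        row_free (\mxcol_i T i) &
        forall i, T i *m M = conblock_mx (b i) *m (T i) ^conj].
Proof.
have blockE m (T : 'M[R[i]]_(\sum_(i < r) conblock_dim (b i), m)) N :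
    T *m N = (\mxdiag_i conblock_mx (b i)) *m T ^conj <->
    forall i, submxcol T i *m N = conblock_mx (b i) *m (submxcol T i) ^conj.
  have E : T ^conj = \mxcol_i ((submxcol T i) ^conj).
    by apply/matrixP => i j; rewrite !mxE tagnat.sig2K.
  rewrite -[in T *m N](submxcolK T) mxcol_mul E mul_mxdiag_mxcol.
  by split=> [/eq_mxcolP|/eq_mxcolP].
split=> [[bv [e [S Su SM]]]|[bv e [T Tfree TM]]].
  split=> //; case: n / e M S Su SM => M S Su; rewrite castmx_id => SM.
  exists (submxcol S); first by rewrite submxcolK row_free_unit.
  by apply/blockE; rewrite -SM !mulmxA mulmxV // mul1mx.
split=> //; exists e; case: n / e M T Tfree TM => M T Tfree TM.
set S := \mxcol_i T i in Tfree.
have Su : S \in unitmx by rewrite -row_free_unit.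
exists S => //; rewrite castmx_id -mulmxA.
have /blockE <- : forall i,
    submxcol S i *m M = conblock_mx (b i) *m (submxcol S i) ^conj.
  by move=> i; rewrite mxcolK.
by rewrite mulKmx.
Qed.

(** The eigenvalue of [M *m M ^conj] that a block of [M] produces: it is quadratic
in the parameter of a Jordan block and linear in that of a pair block. *)
Definition conblock_eig (b : conblock R) : R[i] :=
  match b with ConJordan _ l => `|l| ^+ 2 | ConPair _ l => l end.

Lemma conblock_eig_le1 b :
  (`|conblock_eig b| <= 1) = (cabs (conblock_val b) <= 1).
Proof.
rewrite cabs_le; case: b => //= k l.
by rewrite ger0_norm ?exprn_ge0 // expr_le1.
Qed.

Lemma last_row_jordan_block k (l : R[i]) m (N : 'M_(k.+1, m)) :
  row ord_max (jordan_block k.+1 l *m N) = l *: row ord_max N.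
Proof.
rewrite row_mul.
suff -> : row ord_max (jordan_block k.+1 l) = l *: delta_mx 0 ord_max.
  by rewrite -scalemxAl rowE.
apply/rowP => j; rewrite !mxE eqxx /= [ord_max == j]eq_sym.
have -> : (k.+1 == j) = false by rewrite gtn_eqF.
by rewrite addr0; case: (j == _); rewrite ?mulr1 ?mulr0.
Qed.

(** The last row of a Jordan block is [l] times a basis row, so the last row of [T]
is an eigenvector.  In a pair block [M] carries each half of [T] into the
conjugate of the other, so [M *m M ^conj] acts on the lower half as the Jordan
block, and the last row of that half serves. *)
Lemma eigenvalue_conblock n (M : 'M[R[i]]_n) (b : conblock R)
    (T : 'M_(conblock_dim b, n)) :
  conblock_valid b -> (forall j, row j T != 0) ->
  T *m M = conblock_mx b *m T ^conj ->
  eigenvalue (M *m M ^conj) (conblock_eig b).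
Proof.
case: b T => [[|k] l|[|k] l] /= T [] // _ _ Tnz TM.
  apply/eigenvalueP; exists (row ord_max T) => //.
  have xM : row ord_max T *m M = l *: (row ord_max T) ^conj.
    by rewrite -row_mul TM last_row_jordan_block map_row.
  rewrite mulmxA xM -scalemxAl -map_mxM /= xM map_mxZ conjmxK scalerA.
  by rewrite normCK.
set T1 := usubmx T; set T2 := dsubmx T.
have TE : T = col_mx T1 T2 by rewrite vsubmxK.
move: TM; rewrite TE mul_col_mx map_col_mx mul_block_col !mul0mx mul1mx.
rewrite add0r addr0 => /eq_col_mx [T1M T2M].
apply/eigenvalueP; exists (row ord_max T2); last first.
  by have := Tnz (rshift k.+1 ord_max); rewrite row_dsubmx.
rewrite -row_mul mulmxA T2M -mulmxA -map_mxM /= T1M conjmxK.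
exact: last_row_jordan_block.
Qed.

Lemma eigenvalue_con_canonical_form n (M : 'M[R[i]]_n) r
    (b : 'I_r -> conblock R) i :
  con_canonical_form M b -> eigenvalue (M *m M ^conj) (conblock_eig (b i)).
Proof.
move=> /con_canonical_formP [bv _ [T Tfree TM]].
apply: (@eigenvalue_conblock _ _ _ (T i)) => // j.
have -> : row j (T i) = row (tagnat.Rank i j) (\mxcol_i T i).
  by apply/rowP => k; rewrite -[in LHS](mxcolK T) !mxE.
rewrite rowE mulmx_free_eq0 //; apply/eqP => /rowP /(_ (tagnat.Rank i j)) /eqP.
by rewrite !mxE !eqxx oner_eq0.
Qed.

End CanonicalForm.

(** * Canonical forms of symmetric and skew-symmetric matrices *)

Section ConDiagonalization.
Variables (R : realType) (n : nat) (B : 'M[R[i]]_n).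
Hypothesis Bsym : B^T = B \/ B^T = - B.
Local Notation C := R[i].

Local Notation "W ^!" :=
  (orthomx conjC (mx_of_hermitian (hermitian1mx _)) W) : matrix_set_scope.

(** A block together with the rows that it contributes to the con-similarity; the
number of rows depends on the block. *)
Local Notation block := {b : conblock R & 'M[R[i]]_(conblock_dim b, n)}.

Definition is_conblock_basis (g : block) :=
  conblock_valid (tag g) /\
  tagged g *m B = conblock_mx (tag g) *m (tagged g) ^conj.

Definition rows_of r (f : 'I_r -> block) := \mxcol_i tagged (f i).

Definition is_confamily r (f : 'I_r -> block) :=
  (forall i, is_conblock_basis (f i)) /\ row_free (rows_of f).

Definition conmap (x : 'rV[C]_n) : 'rV[C]_n := (x *m B) ^conj.

Lemma conmapK x : conmap (conmap x) = x *m (B *m B ^conj).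
Proof. by rewrite /conmap map_mxM conjmxK mulmxA. Qed.

Lemma conmapE x : x *m B = (conmap x) ^conj.
Proof. by rewrite conjmxK. Qed.

Lemma conmapZ a x : conmap (a *: x) = conjC a *: conmap x.
Proof. by rewrite /conmap -scalemxAl map_mxZ. Qed.

(** This is where the symmetry of [B] is used: [B *m W^T] equals [W *m B]
transposed up to sign, whose columns lie in the span of [W ^t*]. *)
Lemma conmap_ortho m (W : 'M[C]_(m, n)) D x :
  W *m B = D *m W ^conj -> (x <= W^!)%MS -> (conmap x <= W^!)%MS.
Proof.
move=> WB /orthomx1P xW; apply/orthomx1P; rewrite /conmap -map_mxM -mulmxA.
have BW : x *m (B^T *m W^T) = 0.
  by rewrite -trmx_mul WB trmx_mul map_trmx mulmxA xW mul0mx.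
suff -> : x *m (B *m W^T) = 0 by rewrite map_mx0.
case: Bsym BW => ->; first by [].
by rewrite mulNmx mulmxN => /eqP; rewrite oppr_eq0 => /eqP.
Qed.

(** When [B] is symmetric, [B ^conj] is [B ^t*] and [B *m B ^conj] is positive
semidefinite; when [B] is skew it is negative semidefinite.  Hence its
eigenvalues are real, with a sign that depends on the symmetry. *)
Lemma coneigen_dnorm a x : x *m (B *m B ^conj) = a *: x ->
  a * '[x] = '[x *m B] /\ B^T = B \/ a * '[x] = - '[x *m B] /\ B^T = - B.
Proof.
move=> xa; have -> : a * '[x] = (x *m B *m (B ^conj *m x ^t*)) 0 0.
  by rewrite mulmxA -(mulmxA x) xa -scalemxAl mx11Z dotmxE.
case: Bsym => BT; [left|right]; split=> //; rewrite dotmxE trmxC_mul BT //.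
by rewrite map_mxN mulNmx mulmxN mx11N opprK.
Qed.

Lemma conjordan1_basis (s : C) (x : 'rV_n) : 0 <= s -> x *m B = s *: x ^conj ->
  is_conblock_basis (existT _ (ConJordan 1 s) x).
Proof.
move=> s_ge0 xB; split=> //=; rewrite xB.
suff -> : jordan_block 1 s = s%:M by rewrite mul_scalar_mx.
by apply/matrixP => i j; rewrite !mxE !ord1 addr0.
Qed.

(** Let [y] be the image of [x] under [conmap], so that [conmap y = a *: x].  If
[0 <= a], with square root [s], then [y + s *: x] is fixed by [conmap] up to the
factor [s]; if it vanishes, then ['i *: x] is, because [conmap] is
conjugate-linear.  If [a < 0], then [x] and [y] are independent, since
[y = c *: x] would give [a = |c|^2], and they span a pair block. *)
Lemma coneigen_block m (W : 'M[C]_(m, n)) D a (x : 'rV_n) :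
  W *m B = D *m W ^conj ->
  (x <= W^!)%MS -> x != 0 -> x *m (B *m B ^conj) = a *: x ->
  exists g : block, [/\ is_conblock_basis g, row_free (tagged g),
    (tagged g <= W^!)%MS & conblock_eig (tag g) = a].
Proof.
move=> WB xW x_neq0 xa.
have x_gt0 : 0 < '[x] by rewrite dnorm_gt0.
have yW := conmap_ortho WB xW; set y := conmap x in yW.
have yy : conmap y = a *: x by rewrite conmapK.
have rfree (z : 'rV[C]_n) : z != 0 -> row_free z.
  by move=> z0; rewrite /row_free rank_rV z0.
have [a_ge0|a_lt0] : 0 <= a \/ a < 0.
  have -> : a = a * '[x] / '[x] by rewrite mulfK ?gt_eqF.
  case: (coneigen_dnorm xa) => -[-> _].
    by left; rewrite divr_ge0 ?dnorm_ge0.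
  have [->|xB] := eqVneq (x *m B) 0; first by left; rewrite linear0l oppr0 mul0r.
  by right; rewrite mulNr oppr_lt0 divr_gt0 // dnorm_gt0.
- set s := sqrtC a; have s_ge0 : 0 <= s by rewrite sqrtC_ge0.
  have s2 : s ^+ 2 = a by rewrite sqrtCK.
  have sC : conjC s = s by apply/CrealP/ger0_real.
  suff [z [z_neq0 zW zs]] :
      exists z, [/\ z != 0, (z <= W^!)%MS & conmap z = s *: z].
    exists (existT _ (ConJordan 1 s) z); split=> //=; last by rewrite ger0_norm.
      by apply: conjordan1_basis => //; rewrite conmapE zs map_mxZ /= sC.
    exact: rfree.
  have [yx|yx_neq0] := eqVneq (y + s *: x) 0.
    exists ('i *: x); split; first by rewrite scaler_eq0 negb_or neq0Ci.
      exact: scalemx_sub.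
    rewrite conmapZ conjCi -/y; move/eqP: yx; rewrite addr_eq0 => /eqP ->.
    by rewrite scaleNr scalerN opprK !scalerA mulrC.
  exists (y + s *: x); split=> //; first by rewrite addmx_sub ?scalemx_sub.
  rewrite /conmap mulmxDl map_mxD -/(conmap y) -/(conmap _) conmapZ yy sC -s2.
  by rewrite -/y scalerDr scalerA addrC.
- exists (existT _ (ConPair 1 a) (col_mx x y)); split=> //=.
  + split; first by split=> //; left.
    rewrite /= mul_col_mx map_col_mx mul_block_col !mul0mx mul1mx add0r addr0.
    rewrite !conmapE yy -/y.
    suff -> : jordan_block 1 a = a%:M.
      rewrite mul_scalar_mx map_mxZ /=; congr (col_mx _ (_ *: _)).
      exact/CrealP/ltr0_real.
    by apply/matrixP => i j; rewrite !mxE !ord1 addr0.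
  + apply: inj_row_free => u; rewrite -[u]hsubmxK mul_row_col.
    rewrite [lsubmx u]mx11_scalar [rsubmx u]mx11_scalar !mul_scalar_mx.
    set c := lsubmx u 0 0; set d := rsubmx u 0 0 => cd.
    have d0 : d = 0.
      apply/eqP/negPn/negP => d_neq0.
      have yx : y = (- (c / d)) *: x.
        apply: (scalerI d_neq0); rewrite scalerA mulrN mulrC divfK // scaleNr.
        by apply/eqP; rewrite -addr_eq0 addrC cd.
      have := yy; rewrite {1}yx conmapZ -/y yx scalerA => /eqP.
      rewrite -subr_eq0 -scalerBl scaler_eq0 (negPf x_neq0) orbF subr_eq0.
      rewrite mulrC -normCK => /eqP aE.
      by move: a_lt0; rewrite -aE => /lt_geF; rewrite exprn_ge0.
    move: cd => /eqP; rewrite d0 scale0r addr0 scaler_eq0 (negPf x_neq0) orbF.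
    by move=> /eqP ->; rewrite raddf0 row_mx0.
  + by rewrite col_mx_sub xW yW.
Qed.

Definition concons r (g : block) (f : 'I_r -> block) (i : 'I_r.+1) : block :=
  oapp f g (unlift ord0 i).

Lemma concons0 r g (f : 'I_r -> block) : concons g f ord0 = g.
Proof. by rewrite /concons unlift_none. Qed.

Lemma concons_lift r g (f : 'I_r -> block) i : concons g f (lift ord0 i) = f i.
Proof. by rewrite /concons liftK. Qed.

Lemma confamily_cons r g (f : 'I_r -> block) :
  is_confamily f -> is_conblock_basis g -> row_free (tagged g) ->
  (tagged g <= (rows_of f)^!)%MS -> is_confamily (concons g f).
Proof.
case=> fB ffree gB gfree gf; split=> [i|].
  by rewrite /concons; case: (unlift ord0 i).
move: ffree; rewrite /row_free /rows_of !eqmx_col => /eqP ffree.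
rewrite !big_ord_recl !concons0.
under eq_bigr do rewrite concons_lift.
under [X in _ == (_ + X)%N]eq_bigr do rewrite concons_lift.
rewrite mxrank_disjoint_sum ?ffree ?mxrank_gen ?(eqP gfree) //.
apply: orthomx_disj; rewrite genmxE (eqmx_ortho _ (eqmx_sym (eqmx_col _))).
exact: gf.
Qed.

Lemma rows_of_mulmx r (f : 'I_r -> block) : is_confamily f ->
  rows_of f *m B = (\mxdiag_i conblock_mx (tag (f i))) *m (rows_of f) ^conj.
Proof.
case=> fB _; have -> : (rows_of f) ^conj = \mxcol_i (tagged (f i)) ^conj.
  by apply/matrixP => i j; rewrite !mxE.
by rewrite mxcol_mul mul_mxdiag_mxcol; apply/eq_mxcolP => i; case: (fB i).
Qed.

(** The orthogonal complement is invariant under [B *m B ^conj], the square of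
[conmap]; the eigenvector is that of the restriction to the complement. *)
Lemma rows_of_ortho_eigenvector r (f : 'I_r -> block) : is_confamily f ->
  (\sum_(i < r) conblock_dim (tag (f i)) < n)%N ->
  exists a (x : 'rV_n), [/\ (x <= (rows_of f)^!)%MS, x != 0 &
    x *m (B *m B ^conj) = a *: x].
Proof.
move=> fF f_lt; set K := (rows_of f)^!%MS.
have K_gt0 : (0 < \rank K)%N by rewrite rank_ortho (eqP fF.2) subn_gt0.
have [a /eigenvalueP [v va v_neq0]] :=
  eigenvalue_closed (conjmx (row_base K) (B *m B ^conj)) K_gt0.
exists a, (v *m row_base K); split.
- by rewrite (submx_trans (submxMl _ _)) // eq_row_base.
- by rewrite mulmx_free_eq0 ?row_base_free.
rewrite scalemxAl -va -mulmxA -[RHS]mulmxA; congr (v *m _).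
rewrite /conjmx mulmxKpV //.
rewrite (eqmxMr _ (eq_row_base K)) eq_row_base.
apply/row_subP => i; rewrite row_mul -conmapK.
by do 2!apply: (conmap_ortho (rows_of_mulmx fF)); exact: row_sub.
Qed.

(** While the blocks do not fill the space, the orthogonal complement contains an
eigenvector, hence a new block.  All the original blocks are kept, so that a
block prescribed at the start occurs in the final family. *)
Lemma confamily_complete r (f : 'I_r -> block) : is_confamily f ->
  exists r' (f' : 'I_r' -> block), [/\ is_confamily f',
    (\sum_(i < r') conblock_dim (tag (f' i)))%N = n &
    forall i, exists j, f' j = f i].
Proof.
have [d] := ubnP (n - \sum_(i < r) conblock_dim (tag (f i)))%N.
elim: d r f => // d IHd r f; rewrite ltnS => le_d fF.
have le_n : (\sum_(i < r) conblock_dim (tag (f i)) <= n)%N.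
  by rewrite -(eqP fF.2) rank_leq_col.
case: ltngtP le_n => // [f_lt|f_n] _; last first.
  by exists r, f; split=> // i; exists i.
have [a [x [xf x_neq0 xa]]] := rows_of_ortho_eigenvector fF f_lt.
have [g [gB gfree gf _]] := coneigen_block (rows_of_mulmx fF) xf x_neq0 xa.
have g_gt0 : (0 < conblock_dim (tag g))%N.
  case: gB => + _; case: (tag g) => k l /= [k_gt0 _] //.
  by rewrite addn_gt0 k_gt0.
have [|r' [f' [f'F f'n f'f]]] :=
    IHd _ (concons g f) _ (confamily_cons fF gB gfree gf).
  apply: leq_trans le_d; rewrite big_ord_recl concons0.
  under eq_bigr do rewrite concons_lift.
  by rewrite ltn_sub2l // -[X in (X < _)%N]add0n ltn_add2r.
exists r', f'; split=> // i; have [j fj] := f'f (lift ord0 i).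
by exists j; rewrite fj concons_lift.
Qed.

(** The greedy construction starts from the empty family, whose orthogonal
complement contains every eigenvector; the first block then has eigenvalue [a]. *)
Lemma eigenvalue_canonical a : eigenvalue (B *m B ^conj) a ->
  exists r (b : 'I_r -> conblock R) i,
    con_canonical_form B b /\ conblock_eig (b i) = a.
Proof.
move=> /eigenvalueP [x xa x_neq0].
have f0 : 'I_0 -> block by case.
have f0F : is_confamily f0.
  split=> [[]//|]; apply: inj_row_free => v _; apply/rowP => - [j j_lt].
  by exfalso; move: j_lt; rewrite big_ord0.
have xf : (x <= (rows_of f0)^!)%MS.
  apply/orthomx1P/matrixP => i [j j_lt]; exfalso.
  by move: j_lt; rewrite big_ord0.
have [g [gB gfree gf <-]] := coneigen_block (rows_of_mulmx f0F) xf x_neq0 xa.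
have [r [f [fF fn ff]]] := confamily_complete (confamily_cons f0F gB gfree gf).
have [j fj] := ff ord0.
exists r, (fun i => tag (f i)), j; rewrite fj concons0; split=> //.
apply/con_canonical_formP; split=> // [i|]; first by case: (fF.1 i).
exists (fun i => tagged (f i)); first exact: fF.2.
by move=> i; case: (fF.1 i).
Qed.

End ConDiagonalization.

(** The two radii differ in general, since a Jordan block contributes [|l|] to one
and [|l|^2] to the other, but they lie on the same side of 1. *)
Lemma spectral_radius_con_spectral_radius_le1 (R : realType) n
    (B : 'M[R[i]]_n) :
  B^T = B \/ B^T = - B ->
  spectral_radius (B *m B ^conj) <= 1 <-> con_spectral_radius B <= 1.
Proof.
move=> Bsym; split=> [rho_le1|co_le1].
  rewrite /con_spectral_radius.
  have [[x Ex]|E0] :=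
    pselect ([set cabs l | l in con_spectrum B] !=set0)%classic.
    apply: sup_le_ub; first by exists x.
    move=> _ [_ [r [b [i [bB <-]]]] <-]; rewrite -conblock_eig_le1 -cabs_le.
    apply: le_trans rho_le1; apply: eigenvalue_le_spectral_radius.
    exact: eigenvalue_con_canonical_form.
  suff -> : [set cabs l | l in con_spectrum B] = set0 by rewrite sup0.
  by apply/eqP/negPn/negP => /set0P.
apply: spectral_radius_le => // a.
move=> /(eigenvalue_canonical Bsym) [r [b [i [bB <-]]]].
rewrite conblock_eig_le1; apply: le_trans co_le1.
apply: ub_le_sup; last first.
  by exists (conblock_val (b i)) => //; exists r, b, i.
(* The moduli are bounded over all canonical forms, so that [sup] is their
   least upper bound: [|l|^2 <= rho] gives [|l| <= 1 + rho]. *)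
exists (1 + spectral_radius (B *m B ^conj)) => _ [_ [r' [b' [j [b'B <-]]]] <-].
have := eigenvalue_le_spectral_radius (eigenvalue_con_canonical_form j b'B).
set rho := spectral_radius _; case: (b' j) => k l /=; last first.
  by move=> /le_trans; apply; rewrite lerDr.
rewrite cabs_le ger0_norm ?exprn_ge0 // normcE -rmorphXn lecR => l2.
have : 0 <= (cabs l - 1) ^+ 2 by rewrite sqr_ge0.
by nra.
Qed.

Theorem theorem5 (R : realType) (n : nat) (A : 'M[R[i]]_n) :
  ((exists2 X : 'M[R[i]]_n, posdefmx X &
      X + A ^t* *m invmx (X ^conj) *m A = 1%:M) ->
   [/\ spectral_radius (A *m A ^conj) <= 4^-1,
       mxnorm2 A < 1,
       spectral_radius ((A + (A ^conj) ^t*) *m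
                        (A + (A ^conj) ^t*) ^conj) <= 1 &
       spectral_radius ((A - (A ^conj) ^t*) *m
                        (A - (A ^conj) ^t*) ^conj) <= 1]) /\
  (spectral_radius ((A + (A ^conj) ^t*) *m
                    (A + (A ^conj) ^t*) ^conj) <= 1 <->
   con_spectral_radius (A + (A ^conj) ^t*) <= 1) /\
  (spectral_radius ((A - (A ^conj) ^t*) *m
                    (A - (A ^conj) ^t*) ^conj) <= 1 <->
   con_spectral_radius (A - (A ^conj) ^t*) <= 1).
Proof.
rewrite trmxC_conj; split=> [[X Xpos Xeq]|].
  split.
  - exact: spectral_radius_mul_conj_le Xpos Xeq.
  - exact: mxnorm2_solvable_lt1 Xpos Xeq.
  - rewrite -[A^T]scale1r.
    by apply: (spectral_radius_symmetrized_le Xpos Xeq); rewrite normr1.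
  - rewrite -scaleN1r.
    by apply: (spectral_radius_symmetrized_le Xpos Xeq); rewrite normrN1.
split; apply: spectral_radius_con_spectral_radius_le1.
  by left; rewrite linearD /= trmxK addrC.
by right; rewrite linearB /= trmxK opprB.
Qed.
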